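(* Let $n\neq 0$, $m\neq 2$ be nonnegative integers with $m+n\ge 3$, and let $\Omega\subsetneq\mathbb{R}^{n+m}\setminus\mathbb{R}^n$ be an open set. Then $\kappa_{m,n}(\Omega)=\kappa_{m,n}$ provided that one of the following holds: (a) there exist $x_0\in\mathbb{R}^n$ and $r>0$ such that $\Omega$ contains $B_r(x_0,0)\setminus\{y=0\}$; (b) there exists $R>0$ such that $\Omega$ contains the set $\{(x,y):|y|>R\}$.
   Context: Points of $\mathbb{R}^{n+m}=\mathbb{R}^n\times\mathbb{R}^m$ are written $(x,y)$, $x\in\mathbb{R}^n$, $y\in\mathbb{R}^m$; $\mathbb{R}^n$ denotes $\{y=0\}$; $N=n+m$, $2^*=\frac{2N}{N-2}$; $B_r(x_0,0)$ is the open ball of radius $r$ centered at $(x_0,0)$. For an open set $\Omega\subset\mathbb{R}^{n+m}\setminus\mathbb{R}^n$, $$\kappa_{m,n}(\Omega)=\inf\Big\{\int_\Omega\Big(|\nabla u|^2-\Big(\frac{m-2}{2}\Big)^2\frac{u^2}{|y|^2}\Big)dx\,dy : u\in C_0^\infty(\Omega),\ \int_\Omega|u|^{2^*}dx\,dy=1\Big\},$$ and $\kappa_{m,n}=\kappa_{m,n}(\mathbb{R}^{n+m}\setminus\mathbb{R}^n)$. *)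

(* Defs.v *)
From HB Require Import structures.
From mathcomp Require Import all_boot all_order all_algebra.
From mathcomp Require Import all_classical all_reals all_analysis.
Set Implicit Arguments. Unset Strict Implicit. Unset Printing Implicit Defensive.
Import Order.TTheory GRing.Theory Num.Theory.
Import numFieldNormedType.Exports.
Local Open Scope classical_set_scope.
Local Open Scope ring_scope.

(* Points of R^k are row vectors 'rV[R]_k; R^(n+m) = R^n x R^m via
   lsubmx (the x part) and rsubmx (the y part). *)

Section Defs.
Variable R : realType.

Definition enorm (k : nat) (v : 'rV[R]_k) : R := Num.sqrt (\sum_(i < k) v 0 i ^+ 2).

Definition partial (k : nat) (i : 'I_k) (f : 'rV[R]_k -> R) : 'rV[R]_k -> R :=
  fun p => 'D_(delta_mx 0 i) f p.

Definition ipartial (k : nat) (s : seq 'I_k) (f : 'rV[R]_k -> R) : 'rV[R]_k -> R :=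
  foldr (fun i g => partial i g) f s.

Definition smooth (k : nat) (f : 'rV[R]_k -> R) : Prop :=
  forall s : seq 'I_k, continuous (ipartial s f) /\
    forall (i : 'I_k) (p : 'rV[R]_k), derivable (ipartial s f) p (delta_mx 0 i).

Definition support (k : nat) (f : 'rV[R]_k -> R) : set 'rV[R]_k := [set p | f p != 0].

Definition C0inf (k : nat) (Om : set 'rV[R]_k) (f : 'rV[R]_k -> R) : Prop :=
  smooth f /\ compact (closure (support f)) /\ closure (support f) `<=` Om.

(* Lebesgue integral over R^k, computed as the iterated one-dimensional
   Lebesgue integral (Fubini); used only for continuous compactly supported
   integrands. R^0 is a point with unit mass. *)
Fixpoint integralRn (k : nat) : ('rV[R]_k -> R) -> R :=
  match k with
  | 0 => fun f => f 0
  | k'.+1 => fun f =>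
      Rintegral (@lebesgue_measure R) setT
        (fun t : R => integralRn (fun v : 'rV[R]_k' => f (row_mx (t%:M : 'rV[R]_1) v)))
  end.

Variables n m : nat.

Definition crit_exp : R := 2 * (n + m)%:R / ((n + m)%:R - 2).

Definition hardy_energy (u : 'rV[R]_(n + m) -> R) : R :=
  integralRn (fun p => \sum_(i < n + m) (partial i u p) ^+ 2
     - ((m%:R - 2) / 2) ^+ 2 * (u p ^+ 2 / (enorm (rsubmx p) ^+ 2))).

Definition crit_norm (u : 'rV[R]_(n + m) -> R) : R :=
  integralRn (fun p => powR `|u p| crit_exp).

Definition kappa (Om : set 'rV[R]_(n + m)) : \bar R :=
  ereal_inf [set (hardy_energy u)%:E | u in
     [set u | C0inf Om u /\ crit_norm u = 1]].

Definition off_Rn : set 'rV[R]_(n + m) := [set p | rsubmx p != 0].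

Definition kappa_full : \bar R := kappa off_Rn.

End Defs.

(* Main.v *)
(* If u is a test function for the full problem, so is
   u'(p) = l^((N-2)/2) u(l (p - (x0, 0))) for every l > 0 and x0: the exponent
   makes both the critical norm and, since |y| scales linearly and is unaffected
   by translations along {y = 0}, the Hardy energy invariant. The support of u
   is compact and away from {y = 0}, so u' is supported in Omega for l large in
   case (a) (the support shrinks to (x0, 0)) and for l small in case (b) (the
   support escapes to |y| = infinity). *)

Require Import Defs.
From HB Require Import structures.
From mathcomp Require Import all_boot all_order all_algebra.
From mathcomp Require Import all_classical all_reals all_analysis.
From mathcomp Require Import measurable_realfun ring.
Import Order.TTheory GRing.Theory Num.Theory.
Import numFieldNormedType.Exports.
Local Open Scope classical_set_scope.
Local Open Scope ring_scope.

(** Defined on any module so that one map acts on row vectors and, through [R^o], on single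
    coordinates. *)
Definition dilate {K : pzRingType} {V : lmodType K} (l : K) (c p : V) : V :=
  l *: (p - c).

(** The inverse is again a dilation, so a one-sided fact about all dilations yields its converse. *)
Lemma dilateK {K : unitRingType} {V : lmodType K} (l : K) (c : V) :
  l \is a GRing.unit -> cancel (dilate l c) (dilate l^-1 (- (l *: c))).
Proof.
by move=> lU p; rewrite /dilate opprK scalerBr subrK scalerA mulVr// scale1r.
Qed.

(** * Change of variables under a dilation for integrals over the line *)

Section dilated_integral.
Context {R : realType}.
Implicit Types (l a : R) (c : R^o).
Local Notation mu := (@lebesgue_measure R).

Lemma measurable_dilate l c :
  measurable_fun [set: measurableTypeR R] (dilate l c : _ -> measurableTypeR R).
Proof.
apply: measurable_funM => //.
exact: measurable_funB.
Qed.

Lemma dilate_preimage_itv l c (x y : R) : 0 < l ->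
  dilate l c @^-1` `]x, y] = `](x / l + c : R), y / l + c]%classic.
Proof.
move=> l0; apply/seteqP; split=> t /=;
  rewrite !in_itv /= /dilate -lerBlDr -ltrBrDr ltr_pdivrMr// ler_pdivlMr//;
  by rewrite -[l *: _]/(l * _) mulrC.
Qed.

(** By uniqueness of Lebesgue measure: [l] times the pushforward along the dilation gives each
    half-open interval its length. *)
Lemma lebesgue_measure_dilate l c (A : set (measurableTypeR R)) :
  0 < l -> measurable A ->
  mu (dilate l c @^-1` A) = ((l^-1)%:E * mu A)%E.
Proof.
move=> l0 mA.
set phi : measurableTypeR R -> measurableTypeR R := dilate l c.
have mphi : measurable_fun setT phi := measurable_dilate l c.
pose nu : {measure set (measurableTypeR R) -> \bar R} :=
  mscale (NngNum (ltW l0)) (pushforward mu phi).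
have -> : mu A = nu mphi A.
  apply: lebesgue_measure_unique => //= _ [[x y]] _ <-.
  change (mu `]x, y] = l%:E * mu (dilate l c @^-1` `]x, y]))%E.
  rewrite (dilate_preimage_itv _ _ _ _ l0).
  rewrite !lebesgue_measure_itv /= !lte_fin ltrD2r ltr_pM2r ?invr_gt0//.
  case: ifPn => _; last by rewrite mule0.
  by rewrite -!EFinD -EFinM; congr EFin; field; rewrite gt_eqF.
change (mu (dilate l c @^-1` A) = l^-1%:E * (l%:E * mu (dilate l c @^-1` A)))%E.
by rewrite muleA -EFinM mulVf ?mul1e// gt_eqF.
Qed.

Import HBNNSimple.

(** The integral is a supremum over simple [h] below [f], and [a * h (dilate l c t)] is a simple
    function below the dilated integrand whose integral is [a / l] times that of [h]. *)
Lemma le_ge0_integral_dilate l a c (f : R -> \bar R) : 0 < l -> 0 < a ->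
  (forall t, 0 <= f t)%E ->
  ((a / l)%:E * \int[mu]_t f t <= \int[mu]_t (a%:E * f (dilate l c t)))%E.
Proof.
move=> l0 a0 f0.
have al0 : 0 < a / l by rewrite divr_gt0.
rewrite -lee_pdivlMl//.
rewrite [leLHS]ge0_integralTE//; apply: ge_ereal_sup => _ [h hf <-].
rewrite lee_pdivlMl//.
pose h' (t : measurableTypeR R) : R := a * h (dilate l c t).
have mh : measurable_fun [set: measurableTypeR R] h'.
  apply: (@measurable_funM _ (measurableTypeR R) R) => //.
  by apply: (measurableT_comp _ (measurable_dilate l c)).
have fh : finite_set (range h').
  apply: (@sub_finite_set _ _ ((fun y => a * y) @` range h)).
    by move=> _ [t _ <-]; exists (h (dilate l c t)).
  exact: finite_image.
have h0 t : 0 <= h' t by rewrite mulr_ge0// ltW.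
pose H : {nnsfun measurableTypeR R >-> R} :=
  HB.pack_for {nnsfun measurableTypeR R >-> R} h'
    (isMeasurableFun.Build _ _ _ _ h' mh) (FiniteImage.Build _ _ h' fh)
    (isNonNegFun.Build _ _ h' h0).
have -> : ((a / l)%:E * sintegral mu h = sintegral mu H)%E.
  rewrite EFinM -muleA.
  rewrite !sintegralET !ge0_mule_fsumr; last 2 first.
    - by move=> x; rewrite mule_ge0 ?nnsfun_mulemu_ge0// lee_fin invr_ge0 ltW.
    - by move=> x; exact: nnsfun_mulemu_ge0.
  (* The value [x] of [h] becomes the value [a * x] of [h'], taken on the preimage under the
     dilation of the level set of [h] at [x]. *)
  rewrite [RHS](reindex_fsbigT ( *%R a))/=; last first.
    by exists ( *%R a^-1); [apply: mulKf|apply: mulVKf]; rewrite gt_eqF.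
  apply: eq_fsbigr => x _; rewrite (_ : h' = cst a \* (h \o dilate l c))//.
  rewrite preimage_cstM ?gt_eqF// [(_ / a)%R]mulrC mulKf ?gt_eqF//.
  have mhx : measurable (h @^-1` [set x] : set (measurableTypeR R)) by [].
  have := @lebesgue_measure_dilate l c _ l0 mhx.
  rewrite -comp_preimage => ->.
  by rewrite EFinM -muleA (muleCA x%:E).
rewrite ge0_integralTE; last by move=> t; rewrite mule_ge0// lee_fin ltW.
apply: ereal_sup_ubound; exists H => // t /=.
by rewrite EFinM lee_pmul2l.
Qed.

(** The reverse inequality is the previous one for the inverse dilation and the factor [a^-1],
    applied to the dilated integrand. *)
Lemma ge0_integral_dilate l a c (f : R -> \bar R) : 0 < l -> 0 < a ->
  (forall t, 0 <= f t)%E ->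
  (\int[mu]_t (a%:E * f (dilate l c t)) = (a / l)%:E * \int[mu]_t f t)%E.
Proof.
move=> l0 a0 f0; apply/eqP; rewrite eq_le le_ge0_integral_dilate// andbT.
rewrite -lee_pdivrMl ?divr_gt0// invf_div.
have l'0 : 0 < l^-1 by rewrite invr_gt0.
have a'0 : 0 < a^-1 by rewrite invr_gt0.
pose g t := (a%:E * f (dilate l c t))%E.
have g0 t : (0 <= g t)%E by rewrite mule_ge0// lee_fin ltW.
have := @le_ge0_integral_dilate l^-1 a^-1 (- (l *: c)) g l'0 a'0 g0.
rewrite invrK (mulrC a^-1) => /le_trans; apply.
rewrite le_eqVlt; apply/orP; left; apply/eqP; apply: eq_integral => t _.
rewrite /g muleA -EFinM mulVf ?gt_eqF// mul1e; congr f.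
have := @dilateK _ R^o l^-1 (- (l *: c)).
rewrite invrK scalerN scalerA mulVf ?gt_eqF// scale1r opprK; apply.
by rewrite unitfE gt_eqF.
Qed.

(* The integral of an arbitrary, possibly nonmeasurable, function is a difference
   of suprema over simple functions, and dilations permute simple functions. *)
Lemma Rintegral_dilate l a c (f : R -> R) : 0 < l -> 0 < a ->
  Rintegral mu setT (fun t => a * f (dilate l c t)) =
  a / l * Rintegral mu setT f.
Proof.
move=> l0 a0.
pose F := EFin \o f; pose G t := (a%:E * F (dilate l c t))%E.
rewrite -[LHS]/(fine (\int[mu]_t G t)%E)
  -[X in _ = _ * X]/(fine (\int[mu]_t F t)%E).
rewrite integralE [in RHS]integralE.
have -> : (\int[mu]_t G^\+ t =
  \int[mu]_t (a%:E * F^\+ (dilate l c t)))%E.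
  apply: eq_integral => t _.
  by rewrite (@ge0_funeposM _ _ a (F \o dilate l c) (ltW a0)) funepos_comp.
have -> : (\int[mu]_t G^\- t =
  \int[mu]_t (a%:E * F^\- (dilate l c t)))%E.
  apply: eq_integral => t _.
  by rewrite (@ge0_funenegM _ _ a (F \o dilate l c) (ltW a0)) funeneg_comp.
rewrite !ge0_integral_dilate//.
have al0 : 0 < a / l by rewrite divr_gt0.
(* Scaling by the positive [a / l] keeps an infinite integral infinite, and [fine] then gives 0 on
   both sides. *)
case: (integral _ _ _) => [x||]; case: (integral _ _ _) => [y||];
  rewrite ?gt0_muley ?gt0_muleNy ?lte_fin//= ?mulr0// -?mulrBr//.
Qed.

End dilated_integral.

(** * Integrals, derivatives and supports of dilated functions on row vectors *)

Section dilated_function.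
Context {R : realType}.

Lemma dilate_row_mx (k1 k2 : nat) (l : R) (c1 v1 : 'rV[R]_k1) (c2 v2 : 'rV[R]_k2) :
  dilate l (row_mx c1 c2) (row_mx v1 v2) =
  row_mx (dilate l c1 v1) (dilate l c2 v2).
Proof. by rewrite /dilate opp_row_mx add_row_mx scale_row_mx. Qed.

(** Induction on the dimension: the inner integral leaves the factor [a / l ^+ k], which serves as
    the constant of the outer one-dimensional change of variables, hence the general [a]. *)
Lemma integralRn_dilate (k : nat) (l a : R) (c : 'rV[R]_k) (f : 'rV[R]_k -> R) :
  0 < l -> 0 < a ->
  integralRn (fun p => a * f (dilate l c p)) = a / l ^+ k * integralRn f.
Proof.
move=> l0; elim: k a c f => [|k IH] a c f a0 /=.
  by rewrite expr0 divr1; congr (_ * f _); rewrite [LHS]thinmx0.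
pose c1 : R^o := @lsubmx _ _ 1 k c 0 0; pose c2 := @rsubmx _ _ 1 k c.
have cE : c = row_mx c1%:M c2 by rewrite -mx11_scalar hsubmxK.
pose g t := integralRn (fun v : 'rV[R]_k => f (row_mx (t%:M : 'rV_1) v)).
transitivity (Rintegral (@lebesgue_measure R) setT
    (fun t => a / l ^+ k * g (dilate l c1 t))).
  congr Rintegral; apply/funext => t; rewrite /g -(IH a c2)//; congr integralRn.
  apply/funext => v; congr (_ * f _); rewrite cE.
  transitivity (row_mx (dilate l c1%:M t%:M) (dilate l c2 v)).
    exact: (@dilate_row_mx 1 k l c1%:M t%:M c2 v).
  suff -> : dilate l c1%:M t%:M = (dilate l c1 t)%:M :> 'M[R]_1 by [].
  by rewrite /dilate -raddfB /= scale_scalar_mx.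
by rewrite Rintegral_dilate ?divr_gt0 ?exprn_gt0// exprS invfM
  [l^-1 / _]mulrC !mulrA.
Qed.

Lemma continuous_dilate (k : nat) (l : R) (c : 'rV[R]_k) :
  continuous (dilate l c).
Proof.
move=> p; rewrite -[dilate l c]/((fun v => l *: v) \o (fun v => v - c)).
apply: continuous_comp.
  by apply: continuousB; [exact: cvg_id|exact: cst_continuous].
exact: scaler_continuous.
Qed.

(** Allows the increment [h] of a difference quotient to be replaced by [l * h]. *)
Lemma cvg_mulr_dnbhs0 (l : R) : l != 0 -> l * x @[x --> 0^'] --> (0 : R)^'.
Proof.
move=> l0 A; change (nbhs (0 : R) (fun x => x != 0 -> A x) ->
  nbhs (0 : R) (fun x => x != 0 -> A (l * x))) => A0.
have : l * x @[x --> (0 : R)] --> (0 : R).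
  rewrite -[X in _ --> X](mulr0 l); exact: mulrl_continuous.
move=> /(_ _ A0) lA0; apply: filterS (lA0 : nbhs (0 : R) _) => x Ax xn0.
by apply: Ax; rewrite mulf_neq0.
Qed.

(** Chain rule straight from the difference quotient: an increment [h] at [p] is an increment
    [l * h] at [dilate l c p], which brings out the factor [l]. *)
Lemma is_derive_dilate (k : nat) (b l : R) (c p v : 'rV[R]_k)
    (u : 'rV[R]_k -> R) : l != 0 -> derivable u (dilate l c p) v ->
  is_derive p v (fun p => b * u (dilate l c p))
    (b * l * 'D_v u (dilate l c p)).
Proof.
move=> l0 du.
set q := dilate l c p in du *.
have cv : (fun h : R => h^-1 *: (((fun p => b * u (dilate l c p)) \o shift p)
    (h *: v) - b * u q)) @ 0^' --> b * l * 'D_v u q.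
  rewrite (_ : (fun h => _) =
     (fun h => b * l * (h^-1 *: ((u \o shift q) (h *: v) - u q)))
     \o (fun h => l * h)).
    apply: (cvg_comp _ _ (cvg_mulr_dnbhs0 _ l0)).
    by apply: cvgM; [exact: cvg_cst|exact: du].
  apply/funext => h /=.
  have -> : dilate l c (h *: v + p) = (l * h) *: v + q.
    by rewrite /q /dilate -addrA scalerDr scalerA.
  rewrite -![_ *: (_ : R)]/(_ * _) invfM -mulrBr.
  by rewrite !mulrA; congr (_ * _); rewrite mulfK// mulrC.
split; first by apply/cvg_ex; eexists; exact: cv.
exact/cvg_lim.
Qed.

(** Derivatives of a dilated function are again dilated functions with a constant in front, which
    reduces smoothness to that of [u]. *)
Lemma ipartial_dilate (k : nat) (b l : R) (c : 'rV[R]_k) (u : 'rV[R]_k -> R)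
    (s : seq 'I_k) : l != 0 -> smooth u ->
  ipartial s (fun p => b * u (dilate l c p)) =
  fun p => b * l ^+ size s * ipartial s u (dilate l c p).
Proof.
move=> l0 su; elim: s => [|i s IH] /=; first by rewrite expr0 mulr1.
rewrite IH; apply/funext => p; rewrite /partial.
have [_ /(_ i (dilate l c p)) du] := su s.
have /@derive_val -> := is_derive_dilate _ (b * l ^+ size s) _ _ _ _ _ l0 du.
by rewrite exprSr mulrA.
Qed.

Lemma smooth_dilate (k : nat) (b l : R) (c : 'rV[R]_k) (u : 'rV[R]_k -> R) :
  l != 0 -> smooth u -> smooth (fun p => b * u (dilate l c p)).
Proof.
move=> l0 su s; rewrite ipartial_dilate//; have [cu du] := su s; split.
  change (continuous ( *%R (b * l ^+ size s) \o (ipartial s u \o dilate l c))).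
  move=> p; apply: continuous_comp; last exact: mulrl_continuous.
  by apply: continuous_comp; [exact: continuous_dilate|exact: cu].
move=> i p.
by have [] := is_derive_dilate _ (b * l ^+ size s) _ _ _ _ _ l0 (du i (dilate l c p)).
Qed.

(** The new closed support lies in the preimage of the old one, which is closed by continuity and
    compact as an image under the inverse dilation. *)
Lemma C0inf_dilate (k : nat) (b l : R) (c : 'rV[R]_k) (u : 'rV[R]_k -> R)
    (A B : set 'rV[R]_k) :
  l != 0 -> C0inf A u ->
  dilate l c @^-1` closure (Defs.support u) `<=` B ->
  C0inf B (fun p => b * u (dilate l c p)).
Proof.
move=> l0 [su [cu _]] AB.
have sub : closure (Defs.support (fun p => b * u (dilate l c p))) `<=`
    dilate l c @^-1` closure (Defs.support u).
  rewrite [X in _ `<=` X](iffLR (closure_id _)); last first.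
    apply: preimage_closed; last exact: closed_closure.
    by move=> ? _; exact: continuous_dilate.
  apply: closureS => p; rewrite /Defs.support /= mulf_eq0 negb_or => /andP[_ up].
  exact: subset_closure.
split; first exact: smooth_dilate.
split; last exact: subset_trans AB.
apply: (subclosed_compact (@closed_closure _ _) _ sub).
rewrite (_ : _ @^-1` _ = dilate l^-1 (- (l *: c)) @` closure (Defs.support u)).
  apply: continuous_compact cu.
  by apply: continuous_subspaceT; exact: continuous_dilate.
have K := @dilateK _ _ l c; have K' := @dilateK _ _ l^-1 (- (l *: c)).
apply/seteqP; split=> [p /= Sp|_ [q Sq <-] /=].
  by exists (dilate l c p) => //; apply: K; rewrite unitfE.
have := K' _ q; rewrite invrK scalerN scalerA mulVf// scale1r opprK => ->//.
by rewrite unitfE invr_neq0.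
Qed.
End dilated_function.

(** * The Euclidean norm and its extrema on compact sets *)

Section euclidean_norm.
Context {R : realType}.

Lemma enorm_ge0 (k : nat) (v : 'rV[R]_k) : 0 <= enorm v.
Proof. exact: sqrtr_ge0. Qed.

Lemma enormZ (k : nat) (l : R) (v : 'rV[R]_k) : 0 <= l ->
  enorm (l *: v) = l * enorm v.
Proof.
move=> l0; rewrite /enorm -[in RHS](ger0_norm l0) -sqrtr_sqr.
rewrite -sqrtrM ?sqr_ge0// mulr_sumr.
by congr Num.sqrt; apply: eq_bigr => i _; rewrite mxE exprMn.
Qed.

Lemma enorm_eq0 (k : nat) (v : 'rV[R]_k) : enorm v = 0 -> v = 0.
Proof.
move=> /eqP; rewrite sqrtr_eq0 => v0; apply/rowP => i; rewrite mxE.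
apply/eqP; rewrite -sqrf_eq0 eq_le sqr_ge0 andbT (le_trans _ v0)//.
by rewrite (bigD1 i)//= lerDl sumr_ge0// => j _; exact: sqr_ge0.
Qed.

(** The map [g] lets the same statement cover the full norm and the norm of the y part. *)
Lemma continuous_enorm (T : topologicalType) (k : nat) (g : T -> 'rV[R]_k) :
  (forall i, continuous (fun t => g t 0 i)) -> continuous (fun t => enorm (g t)).
Proof.
move=> cg; pose S (t : T) := \sum_(i < k) g t 0 i ^+ 2.
suff cS : continuous S.
  move=> t; apply: (@continuous_comp _ _ _ S Num.sqrt); first exact: cS.
  exact: sqrt_continuous.
rewrite /S; elim: (index_enum _) => [|i s IH].
  by under eq_fun do rewrite big_nil; exact: cst_continuous.
under eq_fun do rewrite big_cons.
move=> t; apply: cvgD; last exact: IH.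
apply: (@continuous_comp _ _ _ (fun t => g t 0 i) (fun x => x ^+ 2)).
  exact: cg.
exact: exprn_continuous.
Qed.

Lemma compact_enorm_bounded (k : nat) (K : set 'rV[R]_k) : compact K ->
  exists2 M, 0 < M & forall p, K p -> enorm p < M.
Proof.
move=> cK; have [->|/set0P K0] := eqVneq K set0; first by exists 1.
have [|q _ qmax] := @compact_EVT_max _ _ (fun p => enorm p) _ K0 cK.
  apply: continuous_subspaceT; apply: continuous_enorm => i.
  exact: coord_continuous.
(* Adding 1 to the maximum makes the bound strict and positive. *)
exists (enorm q + 1) => [|p Kp]; first by rewrite ltr_wpDl ?enorm_ge0.
by rewrite (le_lt_trans (qmax p (mem_set Kp)))// ltrDl.
Qed.

(** The minimum of |y| over a nonempty [K] is attained, hence nonzero because [K] avoids y = 0. *)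
Lemma compact_enorm_rsubmx_gt (n m : nat) (K : set 'rV[R]_(n + m)) :
  compact K -> K `<=` @off_Rn R n m ->
  exists2 d, 0 < d & forall p, K p -> d <= enorm (rsubmx p).
Proof.
move=> cK sK; have [->|/set0P K0] := eqVneq K set0; first by exists 1.
have [|q Kq qmin] := @compact_EVT_min _ _ (fun p => enorm (rsubmx p)) _ K0 cK.
  apply: continuous_subspaceT; apply: continuous_enorm => i.
  under eq_fun do rewrite mxE; exact: coord_continuous.
exists (enorm (rsubmx q)) => [|p Kp]; last exact: qmin (mem_set Kp).
rewrite lt_neqAle enorm_ge0 andbT; apply/eqP => /esym/enorm_eq0 q0.
by have := sK _ (set_mem Kq); rewrite /off_Rn /= q0 eqxx.
Qed.
End euclidean_norm.

(** * Scaling invariance and comparison of the infima *)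

Section dilated_energy.
Context {R : realType} {n m : nat}.
Local Notation N := (n + m)%N.

(** The squared gradient gains [(b * l) ^+ 2]; so does the Hardy term, as the centre lies on y = 0
    and the y part is only scaled. This factor [l ^+ N] cancels the Jacobian. *)
Lemma hardy_energy_dilate (b l : R) (x0 : 'rV[R]_n) (u : 'rV[R]_N -> R) :
  0 < l -> smooth u -> (b * l) ^+ 2 = l ^+ N ->
  hardy_energy (fun p => b * u (dilate l (row_mx x0 0) p)) = hardy_energy u.
Proof.
move=> l0 su bl; set c := row_mx x0 0.
pose F p := \sum_(i < N) (partial i u p) ^+ 2 - ((m%:R - 2) / 2) ^+ 2 *
  (u p ^+ 2 / (enorm (@rsubmx _ _ n m p) ^+ 2)).
have lN0 : 0 < l ^+ N by rewrite exprn_gt0.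
transitivity (integralRn (fun p => l ^+ N * F (dilate l c p))); last first.
  by rewrite integralRn_dilate// divff ?mul1r// gt_eqF.
congr integralRn; apply/funext => p; rewrite /F mulrBr; congr (_ - _).
  rewrite mulr_sumr; apply: eq_bigr => i _.
  have [_ /(_ i (dilate l c p)) du] := su [::].
  have /@derive_val E := is_derive_dilate _ b _ _ _ _ _ (lt0r_neq0 l0) du.
  by rewrite /partial E exprMn bl.
rewrite [RHS]mulrCA; congr (_ * _).
have -> : rsubmx (dilate l c p) = l *: rsubmx p.
  by rewrite /dilate linearZ linearB /= row_mxKr subr0.
rewrite enormZ ?ltW// !exprMn -bl exprMn.
(* At y = 0 both Hardy quotients vanish, since [0^-1] is 0. *)
have [->|q0] := eqVneq (enorm (@rsubmx _ _ n m p)) 0.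
  by rewrite expr0n /= mulr0 invr0 !mulr0.
by field; rewrite q0 gt_eqF.
Qed.

Lemma crit_norm_dilate (b l : R) (c : 'rV[R]_N) (u : 'rV[R]_N -> R) :
  0 < b -> 0 < l -> b `^ crit_exp R n m = l ^+ N ->
  crit_norm (fun p => b * u (dilate l c p)) = crit_norm u.
Proof.
move=> b0 l0 bl.
have lN0 : 0 < l ^+ N by rewrite exprn_gt0.
pose F q := `|u q| `^ crit_exp R n m.
transitivity (integralRn (fun p => l ^+ N * F (dilate l c p))).
  congr integralRn; apply/funext => p.
  by rewrite normrM powRM// ger0_norm ?bl// ltW.
by rewrite integralRn_dilate// divff ?mul1r// gt_eqF.
Qed.

Lemma le_kappa (A B : set 'rV[R]_N) : A `<=` B ->
  (@kappa R n m B <= @kappa R n m A)%E.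
Proof.
move=> AB; apply: le_ereal_inf => _ [u [[su [cu uA]] u1] <-].
by exists u => //; split=> //; split=> //; split=> //; exact: subset_trans AB.
Qed.

(** Each test function on [A] is dilated into one on [B] of the same energy and critical norm, so it
    only remains to move compact subsets of [A] into [B]. *)
Lemma kappa_le_dilate (A B : set 'rV[R]_N) : (3 <= N)%N ->
  (forall K, compact K -> K `<=` A -> exists2 l : R, 0 < l &
    exists x0 : 'rV[R]_n, dilate l (row_mx x0 0) @^-1` K `<=` B) ->
  (@kappa R n m B <= @kappa R n m A)%E.
Proof.
move=> N3 AB; apply: le_ereal_inf_tmp => _ [u [[su [cu uA]] u1] <-].
have [l l0 [x0 lB]] := AB _ cu uA.
have N2 : N%:R - 2 != 0 :> R.
  by rewrite subr_eq0 eqr_nat; apply/eqP => N2; rewrite N2 in N3.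
(* With this exponent, [b] to the power [crit_exp] and [(b * l) ^+ 2] both equal [l ^+ N]. *)
pose b := l `^ ((N%:R - 2) / 2); have b0 : 0 < b by rewrite powR_gt0.
apply: ereal_inf_lbound; exists (fun p => b * u (dilate l (row_mx x0 0) p)).
  split; first by apply: C0inf_dilate (conj su (conj cu uA)) lB; rewrite gt_eqF.
  rewrite crit_norm_dilate// /b -powRrM -powR_mulrn ?ltW//.
  by congr (_ `^ _); rewrite /crit_exp; move: N%:R N2 => x x2; field.
congr EFin; apply: hardy_energy_dilate => //.
rewrite exprMn /b -(powR_mulrn 2 (powR_ge0 _ _)) -powRrM.
rewrite divfK// -!powR_mulrn ?ltW// -powRD ?subrK//.
by rewrite (gt_eqF l0) implybT.
Qed.
End dilated_energy.

Theorem theorem1p3 (R : realType) (n m : nat) (Om : set 'rV[R]_(n + m)) :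
  n <> 0%N -> m <> 2%N -> (3 <= n + m)%N ->
  open Om -> Om `<=` @off_Rn R n m -> Om <> @off_Rn R n m ->
  ((exists (x0 : 'rV[R]_n) (r : R), 0 < r /\
      [set p | enorm (p - row_mx x0 (0 : 'rV[R]_m)) < r /\ rsubmx p != 0] `<=` Om)
   \/
   (exists R0 : R, 0 < R0 /\ [set p : 'rV[R]_(n + m) | R0 < enorm (rsubmx p)] `<=` Om)) ->
  @kappa R n m Om = @kappa_full R n m.
Proof.
move=> _ _ N3 _ Omoff _ H; apply/eqP; rewrite eq_le.
(* Monotonicity bounds the full infimum by that of [Om]; the other inequality needs dilations. *)
apply/andP; split; last exact: le_kappa.
apply: kappa_le_dilate => // K cK Koff.
have rE l x0 p :
    rsubmx (dilate l (row_mx x0 (0 : 'rV[R]_m)) p) = l *: rsubmx p.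
  by rewrite /dilate linearZ linearB /= row_mxKr subr0.
case: H => [[x0 [r [r0 sub]]]|[R0 [R00 sub]]].
  have [M M0 KM] := compact_enorm_bounded _ _ cK.
  have Mr0 : 0 < M / r by rewrite divr_gt0.
  (* If [p] is sent into [K], then [M / r] times its distance to the centre is below [M], so that
     distance is below [r]. *)
  exists (M / r) => //; exists x0 => p Kp; apply: sub; split.
    have := KM _ Kp; rewrite /dilate enormZ ?ltW//.
    by rewrite -ltr_pdivlMl// invf_div divfK// gt_eqF.
  apply/eqP => p0; have := Koff _ Kp.
  by rewrite /off_Rn /= rE p0 scaler0 eqxx.
have [d d0 Kd] := compact_enorm_rsubmx_gt _ _ _ cK Koff.
(* With this ratio, |y| is at least [R0 + 1] on the preimage of [K], hence above [R0]; the centre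
   does not affect |y|, so 0 will do. *)
have l0 : 0 < d / (R0 + 1) by rewrite divr_gt0// addr_gt0.
exists (d / (R0 + 1)) => //; exists 0 => p Kp; apply: sub => /=.
have := Kd _ Kp; rewrite rE (enormZ _ _ _ (ltW l0)).
rewrite -(ler_pdivrMl _ _ l0) invf_div divfK ?gt_eqF//.
by apply: lt_le_trans; rewrite ltrDl.
Qed.
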